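(* Let $n\ge3$. For every $M\in N_n^+$ and all $1\le i<j\le n-1$, $$y_{ij}(M')=\bar y_{i,n+i-j}(M),\qquad y_{ij}(M'')=\bar y_{j-i,j}(M),$$ $$y_{ij}\Bigl(\bigl((M')''\bigr)'\Bigr)=y_{ij}\Bigl(\bigl((M'')'\bigr)''\Bigr),\qquad \bar y_{ij}\Bigl(\bigl((M')''\bigr)'\Bigr)=\bar y_{ij}\Bigl(\bigl((M'')'\bigr)''\Bigr).$$
   Context: Matrices: $B_n$ is the group of $n\times n$ real invertible upper triangular matrices and $N_n\subset B_n$ its unipotent subgroup (ones on the diagonal). $G\in B_n$ is totally positive if every minor of $G$ that does not vanish identically (as a function on $B_n$) is positive. $N_n^+\subset N_n$ is the subset of totally positive matrices. Jacobi coordinates: for $1\le k\le n-1$, $J_k(x)=\exp(xe_k)\in N_n$ with $(e_k)_{ij}=\delta_{ik}\delta_{j,k+1}$. It is known that every $M\in N_n^+$ has a unique representation $M=\mathbb J_1\cdots\mathbb J_{n-1}$, $\mathbb J_k=J_k(x_{1,k+1})J_{k-1}(x_{2,k+1})\cdots J_1(x_{k,k+1})$, with positive reals $x_{ij}=x_{ij}(M)$, $1\le i<j\le n$ (the Jacobi coordinates of $M$), and conversely every such product lies in $N_n^+$. Maps $M\mapsto M',M''$: let $P$ be the $n\times n$ matrix with $P_{ij}=\delta_{i+j,n+1}$. For every $M\in N_n^+$ there exist unique $M',M''\in N_n^+$ and a unique diagonal matrix $D_M$ such that $PMP=M'PD_MM''$. $\bar M\in N_n^+$ is the matrix with $x_{ij}(\bar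 M)=1/x_{ij}(M)$ for all $1\le i<j\le n$. The functions $y_{ij},\bar y_{ij}:N_n^+\to\mathbb R$, $1\le i<j\le n-1$, are $$y_{ij}(M)=\frac{x_{ij}(M)}{x_{i+1,j+1}(M)},\qquad \bar y_{ij}(M)=y_{ij}(\bar M).$$ *)

(* Defs.v *)
(* MathComp / MathComp-Analysis. *)
From HB Require Import structures.
From mathcomp Require Import all_boot all_order all_algebra.
From mathcomp Require Import all_classical all_reals all_analysis.

Set Implicit Arguments.
Unset Strict Implicit.
Unset Printing Implicit Defensive.

Import Order.TTheory GRing.Theory Num.Theory.
Import numFieldNormedType.Exports.

Local Open Scope classical_set_scope.
Local Open Scope ring_scope.

(* Rows and columns of matrices are indexed from 0 (by 'I_n), whereas the
   indices k of the generators e_k, J_k and the indices (i, j) of the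
   coordinates x_ij, y_ij are natural numbers counted from 1. *)

Section TotallyPositive.
Variables (R : realType) (n : nat).
Implicit Types G M : 'M[R]_n.

Definition upper_triangular G : Prop :=
  forall i j : 'I_n, (j < i)%N -> G i j = 0.

Definition Bn : set 'M[R]_n :=
  [set G | G \in unitmx /\ upper_triangular G].

Definition Nn : set 'M[R]_n :=
  [set G | Bn G /\ forall i : 'I_n, G i i = 1].

Definition increasing_idx (k : nat) (f : 'I_k -> 'I_n) : Prop :=
  forall a b : 'I_k, (a < b)%N -> (f a < f b)%N.

Definition minor (k : nat) (f g : 'I_k -> 'I_n) G : R := \det (mxsub f g G).

Definition totally_positive G : Prop :=
  forall (k : nat) (f g : 'I_k -> 'I_n),
    increasing_idx f -> increasing_idx g ->
    (exists2 H, Bn H & minor f g H != 0) -> 0 < minor f g G.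

Definition Nn_plus : set 'M[R]_n := [set M | Nn M /\ totally_positive M].

End TotallyPositive.

Section JacobiCoordinates.
Variables (R : realType) (n : nat).
Implicit Types M : 'M[R]_n.

(* The exponential series, summed entrywise. *)
Definition expmx (A : 'M[R]_n) : 'M[R]_n :=
  \matrix_(i, j) limn (series (fun m : nat => (A ^+ m) i j / m`!%:R)).

Definition e_mx (k : nat) : 'M[R]_n :=
  \matrix_(i, j) ((i.+1 == k) && (j.+1 == k.+1))%:R.

Definition J_mx (k : nat) (x : R) : 'M[R]_n := expmx (x *: e_mx k).

(* J_k(x_{1,k+1}) J_{k-1}(x_{2,k+1}) ... J_1(x_{k,k+1}) *)
Definition JJ_mx (x : nat -> nat -> R) (k : nat) : 'M[R]_n :=
  \prod_(1 <= i < k.+1) J_mx (k.+1 - i) (x i k.+1).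

Definition jacobi_prod (x : nat -> nat -> R) : 'M[R]_n :=
  \prod_(1 <= k < n) JJ_mx x k.

(* Only the values x i j with 1 <= i < j <= n are meaningful. *)
Definition is_jacobi_coord M (x : nat -> nat -> R) : Prop :=
  (forall i j : nat, (1 <= i)%N -> (i < j)%N -> (j <= n)%N -> 0 < x i j) /\
  M = jacobi_prod x.

(* Representations as in is_jacobi_coord exist and are unique on Nn_plus;
   off Nn_plus the default value may be returned. *)
Definition jacobi_coord M : nat -> nat -> R :=
  xget (fun _ _ => 0) [set x | is_jacobi_coord M x].

Definition bar_mx M : 'M[R]_n :=
  jacobi_prod (fun i j => (jacobi_coord M i j)^-1).

Definition y_coord (i j : nat) M : R :=
  jacobi_coord M i j / jacobi_coord M i.+1 j.+1.

Definition ybar_coord (i j : nat) M : R := y_coord i j (bar_mx M).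

End JacobiCoordinates.

Section PrimeMaps.
Variables (R : realType) (n : nat).
Implicit Types M : 'M[R]_n.

(* With 0-based indices, i + j = n + 1 reads i.+1 + j.+1 = n.+1. *)
Definition P_mx : 'M[R]_n := \matrix_(i, j) (i.+1 + j.+1 == n.+1)%:R.

Definition is_prime_pair M (W : 'M[R]_n * 'M[R]_n) : Prop :=
  [/\ Nn_plus W.1, Nn_plus W.2 &
      exists2 D : 'M[R]_n, is_diag_mx D &
        P_mx *m M *m P_mx = W.1 *m P_mx *m D *m W.2].

(* (M', M''); the pair exists and is unique for M in Nn_plus. *)
Definition prime_pair M : 'M[R]_n * 'M[R]_n :=
  xget (0, 0) [set W | is_prime_pair M W].

Definition mprime M : 'M[R]_n := (prime_pair M).1.

Definition mdprime M : 'M[R]_n := (prime_pair M).2.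

End PrimeMaps.

(* Main.v *)
(* For 1 <= m <= j <= n let f_m(j) be the minor of M with rows j-m+1, ..., j and
   the last m columns.  Every block J_k(x_{1,k+1}) ... J_1(x_{k,k+1}) is
   bidiagonal, so that f_m(j) is the product of the x_{l,k} with l <= m and k > j;
   hence x_{m,k} = f_m(k-1) f_{m-1}(k) / (f_m(k) f_{m-1}(k-1)), and a unipotent
   matrix with positive f's is a Jacobi product with positive coordinates.
   If M = T (P K P) (B P) with T diagonal and B upper triangular, then f_m(j)(M)
   is f_m(n+m-j)(K) times factors that cancel in y, so that
   y_{m,k}(M) = 1 / y_{m,n+m-k}(K).  The equation P M P = M' P D M'' has this
   form for the pair (M, M'), which gives the first identity, and also for
   (M'', S M'^-1 S) with S = diag((-1)^i).  The matrix S M'^-1 S is the Jacobi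
   product of M' read backwards; commuting distant factors brings it back to the
   standard order, with x_{ij} replaced by x_{n+1-j,n+1-i}, and the second
   identity follows.  As ybar = 1/y, the last two identities are obtained by
   applying the first two repeatedly. *)
Require Import Defs.
From HB Require Import structures.
From mathcomp Require Import all_boot all_order all_algebra.
From mathcomp Require Import all_classical all_reals all_analysis.
From mathcomp Require Import perm zify ring.

Set Implicit Arguments.
Unset Strict Implicit.
Unset Printing Implicit Defensive.

Import Order.TTheory GRing.Theory Num.Theory.
Import numFieldNormedType.Exports.

Local Open Scope classical_set_scope.
Local Open Scope ring_scope.

(** * Bidiagonal factors *)

Section JacobiFactors.
Variables (R : realType) (n : nat).
Implicit Types (A : 'M[R]_n) (x : nat -> nat -> R).

Lemma mul_e_mx k l : l != k.+1 -> e_mx R n k *m e_mx R n l = 0.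
Proof.
move=> lk; apply/matrixP => i j; rewrite !mxE big1 // => p _; rewrite !mxE -natrM.
by case: andP => [[_ /eqP pk]|_] //; case: andP => [[/eqP pl _]|_] //; lia.
Qed.

(** The series stops after its linear term because [e_mx R n k] squares to zero. *)
Lemma J_mxE k (x : R) : J_mx n k x = 1%:M + x *: e_mx R n k.
Proof.
have sq0 m : (x *: e_mx R n k) ^+ m.+2 = 0.
  rewrite 2!exprS mulrA.
  suff -> : (x *: e_mx R n k) * (x *: e_mx R n k) = 0 by rewrite mul0r.
  by rewrite -[LHS]/(_ *m _) -scalemxAl -scalemxAr mul_e_mx ?scaler0 //; lia.
apply/matrixP => i j; rewrite mxE; apply: lim_near_cst => //; exists 2%N => //= m m2.
rewrite /series /= (@big_cat_nat _ _ _ 2) //= [X in _ + X]big_nat_cond [X in _ + X]big1 ?addr0.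
  by rewrite big_ltn // big_nat1 expr0 expr1 !mxE !divr1.
by move=> [|[|p]] // _; rewrite sq0 mxE mul0r.
Qed.

(** A column operation. The guarded sum has at most one term and avoids building an ordinal for
    [k - 1]. *)
Lemma mul_J_mxE A k (x : R) (i j : 'I_n) :
  (A *m J_mx n k x) i j =
  A i j + \sum_(p < n | (p.+1 == k) && (j == k :> nat)) x * A i p.
Proof.
rewrite J_mxE mulmxDr mulmx1 mxE; congr (_ + _).
rewrite mxE [RHS]big_mkcond; apply: eq_bigr => p _.
rewrite !mxE eqSS; case: ifP => _; rewrite /= ?mulr1 ?mulr0 //; ring.
Qed.

(** The indices of the factors decrease along the block, so each column operation copies from a
    column that is still an identity column. *)
Lemma JJ_mxE x k (i j : 'I_n) :
  JJ_mx n x k i j = (i == j)%:R +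
    ((i.+1 == j) && (j <= k)%N)%:R * x (k.+1 - j)%N k.+1.
Proof.
pose B := fun r => \matrix_(i, j < n) ((i == j)%:R +
    ((i.+1 == j) && (k - r < j <= k)%N)%:R * x (k.+1 - j)%N k.+1) : 'M[R]_n.
suff step r : (r <= k)%N ->
    \prod_(1 <= l < r.+1) J_mx n (k.+1 - l) (x l k.+1) = B r.
  by rewrite /JJ_mx step // mxE subnn; case: (i.+1 =P j :> nat) => [<-|].
elim: r => [_|r IH rk].
  rewrite big_geq //; apply/matrixP => p q; rewrite !mxE subn0.
  by rewrite (leqNgt q) andbN andbF mul0r addr0.
rewrite big_nat_recr //= IH; last by lia.
apply/matrixP => p q; rewrite [LHS]mul_J_mxE !mxE.
have -> : (k - r.+1 < q <= k)%N = (q == (k.+1 - r.+1)%N :> nat) || (k - r < q <= k)%N by lia.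
have [qE|/= qN] := eqVneq (q : nat) (k.+1 - r.+1)%N; last first.
  by rewrite big1 ?addr0 // => s; rewrite andbF.
have q0 : (q.-1 < n)%N by have := ltn_ord q; lia.
rewrite (big_pred1 (Ordinal q0)); last first.
  move=> s /=; rewrite -val_eqE /= andbT; lia.
rewrite mxE -!val_eqE /=.
have -> : (k - r < q.-1 <= k)%N = false by lia.
have -> : (k - r < q <= k)%N = false by lia.
rewrite !andbF !mul0r !addr0 andbT mulrC; congr (_ + _ * _); last by congr x; lia.
congr (_%:R); lia.
Qed.

Lemma JJ_mx_id x k (i j : 'I_n) : (k < j)%N -> JJ_mx n x k i j = (i == j)%:R.
Proof. by move=> kj; rewrite JJ_mxE leqNgt kj andbF mul0r addr0. Qed.

End JacobiFactors.

(** * Minors and total positivity *)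

Section Minors.
Variables (R : realType) (n : nat).
Implicit Types (A : 'M[R]_n) (x : nat -> nat -> R).

Lemma eq_minor k (f f' g g' : 'I_k -> 'I_n) A :
  f =1 f' -> g =1 g' -> minor f g A = minor f' g' A.
Proof. by move=> ff' gg'; congr (\det _); apply: eq_mxsub. Qed.

Lemma minor_tr k (f g : 'I_k -> 'I_n) A : minor f g A^T = minor g f A.
Proof. by rewrite /minor -[RHS]det_tr trmx_mxsub. Qed.

Lemma increasing_idx_inj k (f : 'I_k -> 'I_n) : increasing_idx f -> injective f.
Proof.
move=> fI a b fab; apply/val_inj => /=.
by case: (ltngtP a b) => // /fI; rewrite fab ltnn.
Qed.

(** Every term of the Leibniz expansion contains an entry below the diagonal. *)
Lemma minor_upper_eq0 k (f g : 'I_k -> 'I_n) A (a : 'I_k) :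
  upper_triangular A -> increasing_idx f -> increasing_idx g ->
  (g a < f a)%N -> minor f g A = 0.
Proof.
move=> Aup fI gI gfa; rewrite /minor /determinant big1 // => s _.
(* Pigeonhole: [s] cannot map the indices [>= a] into the indices [> a]. *)
have [b /andP [ab sba]] : exists b : 'I_k, (a <= b)%N && (s b <= a)%N.
  apply/existsP; apply/contraT; rewrite negb_exists => /forallP sP.
  have /subset_leq_card : s @: [set b : 'I_k | (a <= b)%N]%SET \subset
      [set b : 'I_k | (a < b)%N]%SET.
    apply/fintype.subsetP => _ /imsetP [b + ->]; rewrite !inE => ab.
    by have := sP b; rewrite ab /= -ltnNge.
  rewrite card_imset; last exact: perm_inj.
  rewrite leqNgt proper_card //; apply/properP; split.
    by apply/fintype.subsetP => b; rewrite !inE => /ltnW.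
  by exists a; rewrite !inE ?ltnn.
rewrite (bigD1 b) //= mxE Aup ?mul0r ?mulr0 //.
have gle : (g (s b) <= g a)%N.
  by move: sba; rewrite leq_eqVlt => /orP [/eqP/val_inj-> //|/gI/ltnW].
have fle : (f a <= f b)%N.
  by move: ab; rewrite leq_eqVlt => /orP [/eqP/val_inj-> //|/fI/ltnW].
by apply: leq_ltn_trans gle (leq_trans gfa fle).
Qed.

Definition totally_nonneg A : Prop :=
  forall k (f g : 'I_k -> 'I_n),
    increasing_idx f -> increasing_idx g -> 0 <= minor f g A.

Lemma minor1 k (f : 'I_k -> 'I_n) : increasing_idx f -> minor f f (1%:M : 'M[R]_n) = 1.
Proof.
move=> /increasing_idx_inj fI; rewrite /minor -[RHS](det1 R k); congr (\det _).
by apply/matrixP => a b; rewrite !mxE (inj_eq fI).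
Qed.

Lemma upper_triangular1 : upper_triangular (1%:M : 'M[R]_n).
Proof.
by move=> i j ij; rewrite mxE; case: eqP ij => // ->; rewrite ltnn.
Qed.

Lemma totally_nonneg1 : totally_nonneg (1%:M : 'M[R]_n).
Proof.
move=> k f g fI gI.
have [gf|] := boolP [exists a, g a < f a]%N.
  case/existsP: gf => a gfa.
  by rewrite (minor_upper_eq0 upper_triangular1 fI gI gfa).
rewrite negb_exists => /forallP gf.
have [fg|] := boolP [exists a, f a < g a]%N.
  case/existsP: fg => a fga.
  by rewrite -[1%:M]tr_scalar_mx minor_tr (minor_upper_eq0 upper_triangular1 gI fI fga).
rewrite negb_exists => /forallP fg.
rewrite (@eq_minor _ f f g f) // ?minor1 // => a.
by apply/val_inj/eqP; have := fg a; have := gf a; rewrite /=; lia.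
Qed.

Lemma minor_mul_J_eq k (f g : 'I_k -> 'I_n) A s (t : R) :
  (forall b, g b <> s :> nat) -> minor f g (A *m J_mx n s t) = minor f g A.
Proof.
move=> gs; congr (\det _); apply/matrixP => a b; rewrite [LHS]mxE mul_J_mxE [RHS]mxE.
by rewrite big1 ?addr0 // => p /andP [_ /eqP /gs].
Qed.

Lemma minor_mul_J k (f g g' : 'I_k -> 'I_n) A s (t : R) (b0 : 'I_k) :
  g b0 = s :> nat -> (g' b0).+1 = s -> (forall b, b != b0 -> g' b = g b) ->
  (forall b, b != b0 -> g b <> s :> nat) ->
  minor f g (A *m J_mx n s t) = minor f g A + t * minor f g' A.
Proof.
move=> gb0 g'b0 g'E gs; rewrite /minor -[LHS]det_tr -[X in X + _]det_tr -[X in _ * X]det_tr.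
rewrite -[X in X + _]mul1r; apply: (@determinant_multilinear _ _ _ _ _ b0).
- apply/matrixP => i a; rewrite [LHS]mxE [LHS]mxE [LHS]mxE mul_J_mxE !mxE mul1r.
  congr (_ + _); rewrite (big_pred1 (g' b0)) // => p /=.
  by rewrite gb0 eqxx andbT -g'b0 eqSS.
- apply/matrixP => b a; rewrite [RHS]mxE [RHS]mxE [RHS]mxE mul_J_mxE !mxE big1 ?addr0 //.
  move=> p /andP [_ /eqP].
  by move/gs => -[]; rewrite eq_sym neq_lift.
- apply/matrixP => b a; rewrite [RHS]mxE [RHS]mxE [RHS]mxE mul_J_mxE !mxE big1 ?addr0; last first.
    move=> p /andP [_ /eqP].
    by move/gs => -[]; rewrite eq_sym neq_lift.
  by rewrite g'E // eq_sym neq_lift.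
Qed.

Lemma minor_eq0 k (f g : 'I_k -> 'I_n) A a b : a != b -> g a = g b -> minor f g A = 0.
Proof.
move=> ab gab; rewrite /minor -det_tr; apply: (determinant_alternate ab) => c.
by rewrite !mxE gab.
Qed.

(** The multiplication adds [t] times the minor with column [s] replaced by [s - 1]. Either [s - 1]
    is selected already and two columns coincide, or the selection stays increasing. *)
Lemma minor_mul_J_ge k (f g : 'I_k -> 'I_n) A s (t : R) :
  (0 < s)%N -> 0 <= t -> increasing_idx f -> increasing_idx g -> totally_nonneg A ->
  minor f g A <= minor f g (A *m J_mx n s t).
Proof.
move=> s0 t0 fI gI A0.
have [gs|] := boolP [exists b, g b == s :> nat]; last first.
  rewrite negb_exists => /forallP gs; rewrite minor_mul_J_eq // => b; exact/eqP.
case/existsP: gs => b0 /eqP gb0.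
have g'0 : (s.-1 < n)%N by have := ltn_ord (g b0); lia.
pose g' b := if b == b0 then Ordinal g'0 else g b.
have gs b : b != b0 -> g b <> s :> nat.
  by apply: contra_neq_not => gb; apply: (increasing_idx_inj gI); apply/val_inj; rewrite /= gb.
rewrite (@minor_mul_J _ f g g' _ _ _ b0) ?/g' ?eqxx //=; first last.
- by move=> b /negbTE ->.
- by rewrite prednK.
rewrite lerDl mulr_ge0 //.
have [g's|] := boolP [exists b, g b == s.-1 :> nat].
  case/existsP: g's => b /eqP gb.
  have bb0 : b != b0.
    by apply/eqP => bE; move: gb; rewrite bE; lia.
  rewrite (@minor_eq0 _ _ _ _ b b0) // eqxx (negbTE bb0); exact/val_inj.
rewrite negb_exists => /forallP g's; apply: A0 => // a b ab.
case: eqP => [aE|/eqP/gs aN]; case: eqP => [bE|/eqP/gs bN] /=.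
- by move: ab; rewrite aE bE ltnn.
- by rewrite aE in ab; have := gI _ _ ab; rewrite gb0; lia.
- by rewrite bE in ab; have := gI _ _ ab; rewrite gb0; have /eqP := g's a; lia.
- exact: gI.
Qed.

Lemma totally_nonneg_mul_J A s (t : R) :
  (0 < s)%N -> 0 <= t -> totally_nonneg A -> totally_nonneg (A *m J_mx n s t).
Proof.
move=> s0 t0 A0 k f g fI gI; apply: le_trans (minor_mul_J_ge s0 t0 fI gI A0).
exact: A0.
Qed.

End Minors.

(** * Total positivity of Jacobi products *)

Section JacobiProductPositivity.
Variables (R : realType) (n : nat).
Implicit Types (A : 'M[R]_n) (x : nat -> nat -> R).

(** A product of blocks of index below [k] has identity columns from [k] on, so a nonzero minor
    forces [f a = g a] whenever [g a >= k]. *)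
Definition pos_upto (k : nat) A : Prop :=
  forall m (f g : 'I_m -> 'I_n), increasing_idx f -> increasing_idx g ->
    (forall a, f a <= g a)%N -> (forall a, (k <= g a)%N -> f a = g a) ->
    0 < minor f g A.

Lemma pos_upto1 : pos_upto 1 (1%:M : 'M[R]_n).
Proof.
move=> m f g fI gI fg fg1; rewrite (@eq_minor _ _ _ f f g f) ?minor1 // => a.
case: (posnP (g a)) => [ga0|/fg1-> //].
by apply/val_inj/eqP; have := fg a; rewrite /= ga0; lia.
Qed.

(** The factors [J_k, ..., J_1] are appended one at a time. Each [J_s] allows a selected column [s]
    to be traded for [s - 1]; after all trades the selection lies where [A] is already positive. *)
Lemma pos_upto_mul_JJ x k A : totally_nonneg A -> pos_upto k A ->
  (forall i, (1 <= i <= k)%N -> 0 < x i k.+1) ->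
  totally_nonneg (A *m JJ_mx n x k) /\ pos_upto k.+1 (A *m JJ_mx n x k).
Proof.
move=> A0 Apos x0.
pose P r := A *m \prod_(1 <= i < r.+1) J_mx n (k.+1 - i) (x i k.+1).
have PS r : P r.+1 = P r *m J_mx n (k - r) (x r.+1 k.+1).
  by rewrite /P big_nat_recr //= subSS; exact: mulmxA.
have P0 r : (r <= k)%N -> totally_nonneg (P r).
  elim: r => [_|r IH rk]; first by rewrite /P big_geq // mulmx1.
  rewrite PS; apply: totally_nonneg_mul_J; [lia|by apply/ltW/x0; lia|].
  by apply: IH; lia.
split; first exact: P0.
move=> m f g fI gI fg fgk.
have predP (a : 'I_m) : ((g a).-1 < n)%N by have := ltn_ord (g a); lia.
(* Column indices strictly above the diagonal are moved one step left, starting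
   with the largest: only those [< s] have been moved in [gs s]. *)
pose gs s a := if (g a < s)%N && (f a < g a)%N then Ordinal (predP a) else g a.
have gsI s : increasing_idx (gs s).
  move=> a b ab; rewrite /gs; have := gI _ _ ab; have := fI _ _ ab.
  have := fg a; have := fg b.
  by case: ifP => /= Ha; case: ifP => /= Hb; lia.
suff main r : (r <= k)%N -> 0 < minor f (gs (k.+1 - r)%N) (P r).
  rewrite -[JJ_mx n x k]/(\prod_(1 <= i < k.+1) _) -/(P k).
  rewrite (@eq_minor _ _ _ f f g (gs (k.+1 - k)%N)) ?main // => a.
  by rewrite /gs; case: ifP => //=; have := fg a; lia.
elim: r => [_|r IH rk].
  rewrite /P big_geq // mulmx1 subn0; apply: Apos => // a; rewrite /gs.
    by have := fg a; case: ifP => //=; lia.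
  case: ifP => /= Ha; first lia.
  move=> ka; have := fg a; have [/fgk //|ga fa] := ltnP k (g a).
  by apply/val_inj => /=; lia.
rewrite PS; have rk' : (r <= k)%N by lia.
have {IH} := IH rk'.
have s0 : (0 < k - r)%N by lia.
have x1 : 0 < x r.+1 k.+1 by apply: x0; lia.
set s := (k - r)%N in s0 *; have -> : (k.+1 - r = s.+1)%N by rewrite /s; lia.
rewrite subSS -/s => IH.
have [gb|] := boolP [exists b, (g b == s :> nat) && (f b < g b)%N]; last first.
  rewrite negb_exists => /forallP gb.
  apply: lt_le_trans (minor_mul_J_ge s0 (ltW x1) fI (gsI s) (P0 _ rk')).
  rewrite (@eq_minor _ _ _ f f _ (gs s.+1)) // => a; rewrite /gs.
  by have -> : (g a < s.+1)%N && (f a < g a)%N = (g a < s)%N && (f a < g a)%N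
    by have := gb a; lia.
case/existsP: gb => b /andP [/eqP gb fgb].
have gsb : gs s b = s :> nat by rewrite /gs; case: ifP => //=; lia.
(* The first summand is nonnegative; the second is a positive multiple of the minor for [gs s.+1],
   positive by induction. *)
rewrite (@minor_mul_J _ _ _ f (gs s) (gs s.+1) _ _ _ b) //.
- apply: ltr_wpDl; last exact: mulr_gt0.
  exact: (P0 _ rk' _ _ _ fI (gsI s)).
- by rewrite /gs; case: ifP => /=; lia.
- move=> a ab; rewrite /gs; have gas : g a <> s :> nat.
    by apply: contra_neq_not ab => ga; apply: (increasing_idx_inj gI);
      apply/val_inj; rewrite /= ga.
  by have -> : (g a < s.+1)%N = (g a < s)%N by lia.
- move=> a; apply: contra_neq_not => ga.
  by apply: (increasing_idx_inj (gsI s)); apply/val_inj; rewrite /= ga.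
Qed.

Lemma minor_jacobi_prod_gt0 x m (f g : 'I_m -> 'I_n) :
  (forall i j : nat, (1 <= i)%N -> (i < j)%N -> (j <= n)%N -> 0 < x i j) ->
  increasing_idx f -> increasing_idx g -> (forall a, f a <= g a)%N ->
  0 < minor f g (jacobi_prod n x).
Proof.
move=> x0 fI gI fg.
have [n0|n0] := posnP n.
  have m0 : m = 0%N by case: m f {g fI gI fg} => // m /(_ ord0) [i]; rewrite n0.
  by subst m; rewrite /minor det_mx00 ltr01.
suff main k : (k < n)%N ->
    totally_nonneg (\prod_(1 <= i < k.+1) JJ_mx n x i) /\
    pos_upto k.+1 (\prod_(1 <= i < k.+1) JJ_mx n x i).
  have kn : (n.-1 < n)%N by lia.
  have [_] := main _ kn; rewrite prednK // => pos; apply: pos => // a.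
  by rewrite leqNgt ltn_ord.
elim: k => [_|k IH kn].
  rewrite big_geq //; split; [exact: totally_nonneg1|exact: pos_upto1].
rewrite big_nat_recr //=; have [A0 Apos] := IH (ltnW kn).
by apply: pos_upto_mul_JJ => // i ik; apply: x0; lia.
Qed.

Lemma upper_triangular_mul A B :
  upper_triangular A -> upper_triangular B -> upper_triangular (A *m B).
Proof.
move=> Au Bu i j ji; rewrite mxE big1 // => k _.
have [ki|ik] := ltnP k i; first by rewrite Au // mul0r.
by rewrite Bu ?mulr0 //; apply: leq_trans ji ik.
Qed.

Lemma diag_upper_triangular_mul A B i :
  upper_triangular A -> upper_triangular B -> (A *m B) i i = A i i * B i i.
Proof.
move=> Au Bu; rewrite mxE (bigD1 i) //= big1 ?addr0 // => k ki.
have [lt_ki|ik] := ltnP k i; first by rewrite Au // mul0r.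
by rewrite Bu ?mulr0 //= ltn_neqAle ik andbT eq_sym.
Qed.

Lemma Nn_unitmx A : upper_triangular A -> (forall i, A i i = 1) -> A \in unitmx.
Proof.
move=> Au A1; rewrite unitmxE -det_tr det_trig; last first.
  by apply/is_trig_mxP => i j ij; rewrite mxE Au.
by rewrite big1 ?unitr1 // => i _; rewrite mxE A1.
Qed.

Lemma NnP A : upper_triangular A -> (forall i, A i i = 1) -> Nn A.
Proof. by move=> Au A1; split => //; split => //; exact: Nn_unitmx. Qed.

Lemma Nn1 : Nn (1%:M : 'M[R]_n).
Proof. by apply: NnP; [exact: upper_triangular1|move=> i; rewrite mxE eqxx]. Qed.

Lemma Nn_mul A B : Nn A -> Nn B -> Nn (A *m B).
Proof.
move=> [[_ Au] A1] [[_ Bu] B1]; apply: NnP; first exact: upper_triangular_mul.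
by move=> i; rewrite diag_upper_triangular_mul // A1 B1 mulr1.
Qed.

Lemma Nn_JJ_mx x k : Nn (JJ_mx n x k).
Proof.
apply: NnP => [i j ji|i]; rewrite JJ_mxE.
  have -> : (i == j) = false by apply/negbTE/eqP => ij; move: ji; rewrite ij ltnn.
  have -> : (i.+1 == j) = false by apply/negbTE/eqP => ij; lia.
  by rewrite mul0r addr0.
by rewrite eqxx gtn_eqF // mul0r addr0.
Qed.

Lemma Nn_prod_JJ_mx x k : Nn (\prod_(1 <= l < k) JJ_mx n x l).
Proof.
by elim/big_ind: _ => [|A B|l _]; [exact: Nn1|exact: Nn_mul|exact: Nn_JJ_mx].
Qed.

Lemma Nn_jacobi_prod x : Nn (jacobi_prod n x).
Proof. exact: Nn_prod_JJ_mx. Qed.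

(** The Jacobi product with all coordinates 1 witnesses that a minor with [f <= g] does not vanish
    identically on [Bn]. *)
Lemma Nn_plus_minor_gt0 A m (f g : 'I_m -> 'I_n) : Nn_plus A ->
  increasing_idx f -> increasing_idx g -> (forall a, f a <= g a)%N ->
  0 < minor f g A.
Proof.
move=> [_ Apos] fI gI fg; apply: Apos => //.
exists (jacobi_prod n (fun _ _ => 1)); first by have [] := Nn_jacobi_prod (fun _ _ => 1).
by apply/lt0r_neq0/minor_jacobi_prod_gt0 => // i j *; exact: ltr01.
Qed.

Lemma Nn_plusP A : Nn A ->
  (forall m (f g : 'I_m -> 'I_n), increasing_idx f -> increasing_idx g ->
     (forall a, f a <= g a)%N -> 0 < minor f g A) -> Nn_plus A.
Proof.
move=> NA Apos; split => // m f g fI gI [H [_ Hu] H0]; apply: Apos => // a.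
by rewrite leqNgt; apply: contra_neqN H0; exact: minor_upper_eq0.
Qed.

Lemma jacobi_coord_Nn_plus A x : is_jacobi_coord A x -> Nn_plus A.
Proof.
move=> [x0 ->]; apply: Nn_plusP; first exact: Nn_jacobi_prod.
by move=> m f g; exact: minor_jacobi_prod_gt0.
Qed.

End JacobiProductPositivity.

(** * Corner minors and Jacobi coordinates *)

Section CornerMinors.
Variables (R : realType) (n : nat).
Implicit Types (M U V : 'M[R]_n.+1) (x : nat -> nat -> R) (m j k : nat).

(* The minor with (1-based) rows [j - m + 1, ..., j] and the last [m] columns;
   meaningful for [m <= j <= n.+1]. *)
Definition cminor M m j : R :=
  minor (fun a : 'I_m => inord (j - m + a)) (fun a => inord (n.+1 - m + a)) M.

Lemma increasing_idx_inord m k : (m + k <= n.+1)%N ->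
  increasing_idx (fun a : 'I_m => inord (k + a) : 'I_n.+1).
Proof.
by move=> mk a b ab; rewrite !inordK; have := ltn_ord a; have := ltn_ord b; lia.
Qed.

Lemma cminor_gt0 M m j : Nn_plus M -> (m <= j <= n.+1)%N -> 0 < cminor M m j.
Proof.
move=> NM mj; apply: Nn_plus_minor_gt0 => //.
- by apply: increasing_idx_inord; lia.
- by apply: increasing_idx_inord; lia.
- by move=> a; rewrite !inordK; have := ltn_ord a; lia.
Qed.

Lemma minor_Nn M m (f : 'I_m -> 'I_n.+1) : Nn M -> increasing_idx f -> minor f f M = 1.
Proof.
move=> [[_ Mu] M1] fI; rewrite /minor -det_tr det_trig; last first.
  by apply/is_trig_mxP => a b ab; rewrite !mxE Mu // fI.
by rewrite big1 // => a _; rewrite !mxE M1.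
Qed.

Lemma cminor_last M m : Nn M -> (m <= n.+1)%N -> cminor M m n.+1 = 1.
Proof. by move=> NM mn; apply: minor_Nn => //; apply: increasing_idx_inord; lia. Qed.

Lemma cminor0 M j : cminor M 0 j = 1.
Proof. exact: det_mx00. Qed.

(* The corner minors determine the columns from right to left and, inside a
   column, the entries from bottom to top. *)
Lemma cminor_inj U V : Nn U -> Nn V ->
  (forall m j, (m <= j <= n.+1)%N -> cminor U m j = cminor V m j) ->
  (forall m j, (m <= j <= n.+1)%N -> cminor U m j != 0) -> U = V.
Proof.
move=> [[_ Uu] U1] [[_ Vu] V1] UV U0.
suff main m i : (m < n.+1)%N -> (i < n.+1)%N ->
    U (inord i) (inord (n - m)) = V (inord i) (inord (n - m)).
  apply/matrixP => i j.
  have jE : j = inord (n - (n - j)) by apply/val_inj; rewrite /= inordK; have := ltn_ord j; lia.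
  by rewrite jE -[i]inord_val; apply: main; have := ltn_ord i; lia.
elim/ltn_ind: m i => m IHm i mn.
move: {2}(n - i)%N (erefl (n - i)%N) => p; elim/ltn_ind: p i => p IHi i iE iN.
have [ltic|gtci|eqci] := ltngtP i (n - m)%N; last 2 first.
- by rewrite Uu ?Vu // !inordK //; lia.
- by rewrite eqci U1 V1.
(* Expand along the first column the corner minor with top left entry [(i, n - m)]. Its cofactors
   use columns further right, and the entries below are known by induction. *)
have := UV m.+1 (i + m.+1)%N; rewrite /cminor /minor !(expand_det_col _ ord0).
rewrite addnK !big_ord_recl => /(_ ltac:(lia)).
pose S (W : 'M[R]_n.+1) :=
  mxsub (fun a : 'I_m.+1 => inord (i + a)) (fun a => inord (n.+1 - m.+1 + a)) W
  : 'M[R]_m.+1.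
rewrite -/(S U) -/(S V).
have cofE a : cofactor (S U) a ord0 = cofactor (S V) a ord0.
  congr (_ * \det _); apply/matrixP => b c; rewrite !mxE.
  have bn : (i + lift a b < n.+1)%N by have := ltn_ord (lift a b); lia.
  have cE : (n.+1 - m.+1 + lift ord0 c = n - (m - c.+1))%N.
    by have := ltn_ord c; rewrite lift0 /=; lia.
  by rewrite cE; apply: IHm => //; have := ltn_ord c; lia.
rewrite [in RHS](eq_bigr (fun a => S U (lift ord0 a) ord0 *
    cofactor (S U) (lift ord0 a) ord0)); last first.
  move=> a _; rewrite cofE; congr (_ * _); rewrite !mxE addn0 subSS lift0.
  case: a => a /= am.
  by apply/esym/(IHi (n - (i + a.+1))%N); lia.
move/addIr; rewrite -cofE !mxE !addn0 subSS; apply: mulIf.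
(* The cofactor of the top entry is the corner minor of order [m] on the rows just below [i], hence
   nonzero. *)
have := U0 m (i + m.+1)%N ltac:(lia); congr (_ != 0).
rewrite /cofactor expr0 mul1r; congr (\det _).
apply/matrixP => b c; rewrite !mxE /= /bump /=; congr (U (inord _) (inord _)); lia.
Qed.

Lemma jacobi_prod_id x k (i j : 'I_n.+1) : (k <= j)%N ->
  (\prod_(1 <= l < k) JJ_mx n.+1 x l) i j = (i == j)%:R.
Proof.
elim: k j => [|[|k] IH] j kj; [by rewrite big_geq // mxE|by rewrite big_geq // mxE|].
rewrite big_nat_recr //= [LHS]mxE (bigD1 j) //= IH; last by lia.
rewrite [X in _ + X]big1 ?addr0.
  by rewrite JJ_mx_id // eqxx mulr1.
by move=> p pj; rewrite JJ_mx_id // (negbTE pj) mulr0.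
Qed.

(** With the rows fixed, the window of columns moves right by one with each further block, and the
    minor gains the factor contributed by that block. *)
Lemma cminor_jacobi_prod x m j : (m <= j <= n.+1)%N ->
  cminor (jacobi_prod n.+1 x) m j =
  \prod_(j.+1 <= k < n.+2) \prod_(1 <= l < m.+1) x l k.
Proof.
move=> mj.
suff main d : (j + d <= n.+1)%N ->
    minor (fun a : 'I_m => inord (j - m + a)) (fun a => inord (j + d - m + a))
      (\prod_(1 <= l < (j + d)%N) JJ_mx n.+1 x l) =
    \prod_(j.+1 <= k < (j + d).+1) \prod_(1 <= l < m.+1) x l k.
  have := main (n.+1 - j)%N; rewrite subnKC; last by lia.
  exact.
elim: d => [|d IH] jd.
  rewrite addn0 [RHS]big_geq // minor_Nn //; first exact: Nn_prod_JJ_mx.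
  by apply: increasing_idx_inord; lia.
rewrite addnS [RHS]big_nat_recr; last by lia.
rewrite -IH; last by lia.
rewrite /= mulrC.
have [->|m0] := posnP m.
  by rewrite [X in X * _]big_geq // /minor !det_mx00 mulr1.
rewrite big_nat_recr; last by lia.
set A := \prod_(1 <= l < (j + d)%N) _; set k := (j + d)%N in A jd *.
(* Column [b] of the new window is column [b + 1] of the old one plus [x (m - b) k.+1] times its
   column [b]; this is right multiplication by [T]. *)
pose T := \matrix_(b, c < m) ((b == c)%:R * x (m - c)%N k.+1 + (b == c.+1 :> nat)%:R).
have -> : \prod_(1 <= l < m.+1) x l k.+1 = \det T.
  rewrite det_trig; last first.
    apply/is_trig_mxP => b c bc; rewrite mxE.
    have -> : (b == c) = false by apply/negbTE/eqP => bE; move: bc; rewrite bE ltnn.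
    by have -> : (b == c.+1 :> nat) = false; [lia|rewrite mul0r addr0].
  rewrite big_add1 big_mkord (reindex_inj rev_ord_inj); apply: eq_bigr => b _.
  rewrite mxE eqxx mul1r /= (_ : (b == b.+1 :> nat) = false) ?addr0; last lia.
  by congr x; case: b => b bm /=; lia.
rewrite /= [RHS]mulrC /minor -det_mulmx; congr (\det _); apply/matrixP => a b.
rewrite mxE [LHS]mxE [RHS]mxE.
have am := ltn_ord a; have bm := ltn_ord b.
have p0 : (k - m + b < n.+1)%N by lia.
have q0 : (k - m + b.+1 < n.+1)%N by lia.
rewrite (bigD1 (inord (k - m + b.+1))) //= (bigD1 (inord (k - m + b))) /=; last first.
  by apply/eqP => /(congr1 val) /=; rewrite !inordK //; lia.
rewrite [X in _ + (_ + X)]big1 ?addr0; last first.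
  move=> p /andP [pq pp]; rewrite JJ_mxE.
  have -> : inord (k.+1 - m + b) = inord (k - m + b.+1) :> 'I_n.+1 by congr inord; lia.
  rewrite (negbTE pq) inordK // add0r (_ : (p.+1 == _) = false) ?mul0r ?mulr0 //.
  by apply/negbTE; apply: contra pp => /eqP pE; apply/eqP/val_inj; rewrite /= inordK //; lia.
rewrite !JJ_mxE.
have -> : inord (k.+1 - m + b) = inord (k - m + b.+1) :> 'I_n.+1 by congr inord; lia.
rewrite eqxx -!val_eqE /= !inordK //.
have -> : ((k - m + b.+1).+1 == k - m + b.+1)%N = false by lia.
have -> : (k - m + b == k - m + b.+1)%N = false by lia.
have -> : ((k - m + b).+1 == k - m + b.+1)%N by lia.
have -> : (k - m + b.+1 <= k)%N by lia.
rewrite mul0r addr0 mulr1 add0r mul1r.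
have -> : (k.+1 - (k - m + b.+1) = m - b)%N by lia.
rewrite addrC; under [RHS]eq_bigr do rewrite !mxE mulrDr mulrA.
rewrite big_split /=; congr (_ + _).
  rewrite (bigD1 b) //= big1 ?addr0; first by rewrite eqxx mulr1.
  by move=> c /negbTE ->; rewrite mulr0 mul0r.
have [bm1|bm1] := ltnP b.+1 m.
  rewrite (bigD1 (Ordinal bm1)) //= big1 ?addr0; first by rewrite eqxx mulr1.
  move=> c cb; rewrite (_ : (c == b.+1 :> nat) = false) ?mulr0 //.
  by apply/negbTE; apply: contra cb => /eqP cE; apply/eqP/val_inj.
(* For the last column, the summand outside the old window comes from column [k] of [A], an identity
   column that vanishes in the selected rows. *)
rewrite jacobi_prod_id; last by rewrite inordK //; lia.
rewrite -val_eqE /= !inordK //; last by lia.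
rewrite (_ : (_ == _)%N = false); last by lia.
rewrite big1 // => c _; rewrite (_ : (c == b.+1 :> nat) = false) ?mulr0 //.
by have := ltn_ord c; lia.
Qed.

Definition xminor M m k : R :=
  cminor M m k.-1 * cminor M m.-1 k / (cminor M m k * cminor M m.-1 k.-1).

(** The quotient [cminor M a k.-1 / cminor M a k] is the product of the [x l k] with [l <= a];
    comparing [a = m] with [a = m - 1] isolates [x m k]. Uniqueness of the coordinates follows. *)
Lemma jacobi_coordE M x m k : is_jacobi_coord M x ->
  (1 <= m)%N -> (m < k)%N -> (k <= n.+1)%N -> x m k = xminor M m k.
Proof.
move=> /[dup] /jacobi_coord_Nn_plus NM [x0 ME] m1 mk kn.
have cm0 a b : (a <= b <= n.+1)%N -> cminor M a b != 0.
  by move=> ab; exact/lt0r_neq0/cminor_gt0.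
have cmE a : (a < k)%N ->
    cminor M a k.-1 = \prod_(1 <= l < a.+1) x l k * cminor M a k.
  move=> ak; rewrite ME !cminor_jacobi_prod; try lia.
  rewrite prednK; last by lia.
  by rewrite big_ltn //; lia.
have g0 : \prod_(1 <= l < m) x l k != 0.
  rewrite prodf_seq_neq0; apply/allP => l; rewrite mem_index_iota => lm /=.
  by apply/lt0r_neq0/x0; lia.
rewrite /xminor !cmE //; last by lia.
rewrite prednK // big_nat_recr //=.
have h1 := cm0 m k ltac:(lia); have h2 := cm0 m.-1 k ltac:(lia).
by field; rewrite h1 h2 g0.
Qed.

(** The Jacobi product with coordinates [xminor M] has the corner minors of [M], by telescoping
    first in [l] and then in [k], so [cminor_inj] applies. *)
Lemma jacobi_coord_exists M : Nn M ->
  (forall m j, (m <= j <= n.+1)%N -> 0 < cminor M m j) ->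
  exists x, is_jacobi_coord M x.
Proof.
move=> NM M0; exists (xminor M); split.
  move=> i j i1 ij jn; rewrite /xminor divr_gt0 // mulr_gt0 //; apply: M0; lia.
have cm0 a b : (a <= b <= n.+1)%N -> cminor M a b != 0 by move=> ab; exact/lt0r_neq0/M0.
apply: cminor_inj => // [|m j mj]; first exact: Nn_jacobi_prod.
rewrite cminor_jacobi_prod //.
have inner k : (j < k <= n.+1)%N ->
    \prod_(1 <= l < m.+1) xminor M l k = cminor M m k.-1 / cminor M m k.
  move=> jk; have : (m <= j)%N by lia.
  elim: m {mj} => [_|m IH mj]; first by rewrite big_geq // !cminor0 divr1.
  rewrite big_nat_recr //= IH; last by lia.
  rewrite /xminor /=.
  have h1 := cm0 m.+1 k ltac:(lia); have h2 := cm0 m k ltac:(lia).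
  have h3 := cm0 m k.-1 ltac:(lia).
  by field; rewrite h1 h2 h3.
rewrite (eq_big_nat _ _ (F2 := fun k => cminor M m k.-1 / cminor M m k)); last first.
  by move=> k jk; rewrite inner //; lia.
have [jn|jn] := ltnP j n.+1; last first.
  rewrite big_geq // (_ : j = n.+1) ?cminor_last //; lia.
rewrite big_add1 /= (telescope_prodr_eq (cminor M m)) //.
- by rewrite cminor_last ?divr1 //; lia.
- by move=> k jk; rewrite unitfE cm0 //; lia.
Qed.

End CornerMinors.

(** * The coordinates y under reversal *)

Section Reversal.
Variables (R : realType) (n : nat).
Implicit Types A : 'M[R]_n.

Lemma rev_ord_P (i j : 'I_n) : (i.+1 + j.+1 == n.+1)%N = (j == rev_ord i).
Proof. by rewrite -val_eqE /=; have := ltn_ord i; have := ltn_ord j; lia. Qed.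

Lemma P_mxE (i j : 'I_n) : P_mx R n i j = (j == rev_ord i)%:R.
Proof. by rewrite mxE rev_ord_P. Qed.

Lemma mul_P_mxE A i j : (P_mx R n *m A) i j = A (rev_ord i) j.
Proof.
rewrite mxE (bigD1 (rev_ord i)) //= P_mxE eqxx mul1r big1 ?addr0 // => k ki.
by rewrite P_mxE (negbTE ki) mul0r.
Qed.

Lemma mul_mx_PE A i j : (A *m P_mx R n) i j = A i (rev_ord j).
Proof.
rewrite mxE (bigD1 (rev_ord j)) //= P_mxE rev_ordK eqxx mulr1 big1 ?addr0 // => k kj.
by rewrite P_mxE -(inj_eq rev_ord_inj) rev_ordK eq_sym (negbTE kj) mulr0.
Qed.

Lemma P_mxK : P_mx R n *m P_mx R n = 1%:M.
Proof. by apply/matrixP => i j; rewrite mul_P_mxE P_mxE rev_ordK mxE eq_sym. Qed.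

Lemma P_mx_diag (d : 'rV[R]_n) :
  P_mx R n *m diag_mx d *m P_mx R n = diag_mx (\row_i d 0 (rev_ord i)).
Proof.
apply/matrixP => i j; rewrite mul_mx_PE mul_P_mxE !mxE (inj_eq rev_ord_inj).
by case: eqP => [->|].
Qed.

Lemma det_mxsub_rev A : \det (mxsub (@rev_ord n) (@rev_ord n) A) = \det A.
Proof.
have -> : mxsub (@rev_ord n) (@rev_ord n) A =
    row_perm (perm rev_ord_inj) (col_perm (perm rev_ord_inj) A).
  by apply/matrixP => i j; rewrite !mxE !permE.
rewrite row_permE col_permE !det_mulmx !det_perm odd_permV.
by rewrite mulrCA -signr_addb addbb mulr1.
Qed.

End Reversal.

(** * Corner minors and y for matrices related by conjugation with P *)

Section MinorRelation.
Variables (R : realType) (n : nat).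
Implicit Types (M K B : 'M[R]_n.+1) (d : 'rV[R]_n.+1) (x : nat -> nat -> R) (m j k : nat).

Lemma sum_ord_lead (F : 'I_n.+1 -> R) m : (m <= n.+1)%N ->
  (forall p : 'I_n.+1, (m <= p)%N -> F p = 0) ->
  \sum_p F p = \sum_(p < m) F (inord p).
Proof.
move=> mn F0; pose G p := F (inord p).
rewrite (eq_bigr (fun p : 'I_n.+1 => G p)) => [|p _]; last by rewrite /G inord_val.
rewrite -(big_mkord xpredT G) -[RHS](big_mkord xpredT G) (@big_cat_nat _ _ _ m) //=.
rewrite [X in _ + X]big_nat_cond [X in _ + X]big1 ?addr0 // => p /andP [/andP [mp pn] _].
by rewrite /G F0 // inordK.
Qed.

(** The last [m] columns of [B *m P] are the first [m] columns of [B] reversed, hence supported in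
    the first [m] rows. The minor therefore splits into three determinants, and the one from [B]
    does not depend on [j]. *)
Lemma cminor_rel M K B d : upper_triangular B ->
  M = diag_mx d *m (P_mx R n.+1 *m K *m P_mx R n.+1) *m (B *m P_mx R n.+1) ->
  exists c : nat -> R, forall m j, (m <= j <= n.+1)%N ->
    cminor M m j =
    \prod_(j - m <= r < j) d 0 (inord r) * cminor K m (n.+1 + m - j) * c m.
Proof.
move=> Bu ME.
exists (fun m => minor (fun a : 'I_m => inord a)
  (fun a => inord (n.+1 - m + a)) (B *m P_mx R n.+1)).
move=> m j mj.
have -> : \prod_(j - m <= r < j) d 0 (inord r) =
    \det (diag_mx (\row_(a < m) d 0 (inord (j - m + a)))).
  rewrite det_diag -{1}[(j - m)%N]add0n big_addn subKn ?big_mkord; last by lia.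
  by apply: eq_bigr => a _; rewrite mxE addnC.
rewrite /cminor /minor -[\det (mxsub _ _ K)]det_mxsub_rev -!det_mulmx; congr (\det _).
apply/matrixP => a b; rewrite mxE ME [LHS]mxE [RHS]mxE (@sum_ord_lead _ m); first last.
- move=> p mp; rewrite mul_mx_PE Bu ?mulr0 //= inordK; have := ltn_ord b; lia.
- by lia.
apply: eq_bigr => p _; rewrite [X in _ = _ * X]mxE; congr (_ * _).
rewrite !mul_diag_mx mxE mul_mx_PE mul_P_mxE !mxE; congr (_ * K _ _).
  apply/val_inj; rewrite /= !inordK /=; have := ltn_ord a; lia.
apply/val_inj; rewrite /= !inordK /=; have := ltn_ord p; lia.
Qed.

Lemma Nn_plus_jacobi_coord M : Nn_plus M -> is_jacobi_coord M (jacobi_coord M).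
Proof.
move=> NM; have [||x xM] := @jacobi_coord_exists R n M; first by case: NM.
  by move=> m j; exact: cminor_gt0.
exact: (@xgetI _ _ [set x | is_jacobi_coord M x] x).
Qed.

Lemma y_coord_xminor M m k : Nn_plus M -> (1 <= m)%N -> (m < k)%N -> (k <= n)%N ->
  y_coord m k M = xminor M m k / xminor M m.+1 k.+1.
Proof.
move=> /Nn_plus_jacobi_coord xM m1 mk kn; rewrite /y_coord.
by rewrite !(jacobi_coordE xM) //; lia.
Qed.

Lemma y_coordE M x m k : is_jacobi_coord M x -> (1 <= m)%N -> (m < k)%N -> (k <= n)%N ->
  y_coord m k M = x m k / x m.+1 k.+1.
Proof.
move=> xM m1 mk kn; rewrite y_coord_xminor //; last exact: jacobi_coord_Nn_plus xM.
by rewrite !(jacobi_coordE xM) //; lia.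
Qed.

(** The inverted coordinates are positive, so by uniqueness they are those of [bar_mx M]. *)
Lemma ybar_coordE M m k : Nn_plus M -> (1 <= m)%N -> (m < k)%N -> (k <= n)%N ->
  ybar_coord m k M = (y_coord m k M)^-1.
Proof.
move=> /Nn_plus_jacobi_coord [x0 _] m1 mk kn; rewrite /ybar_coord.
have xbar : is_jacobi_coord (bar_mx M) (fun i j => (jacobi_coord M i j)^-1).
  by split => // i j *; rewrite invr_gt0 x0.
by rewrite (y_coordE xbar) // /y_coord invf_div invrK mulrC.
Qed.

(* Each [y] is a ratio of corner minors in which the row weights [d] and the
   factors [c m] of [cminor_rel] cancel. *)
Lemma y_coord_rel M K B d m k : upper_triangular B ->
  M = diag_mx d *m (P_mx R n.+1 *m K *m P_mx R n.+1) *m (B *m P_mx R n.+1) ->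
  Nn_plus M -> Nn_plus K -> (1 <= m)%N -> (m < k)%N -> (k <= n)%N ->
  y_coord m k M = (y_coord m (n.+1 + m - k) K)^-1.
Proof.
move=> Bu ME NM NK; case: m => // m _ mk kn; have [c cE] := cminor_rel Bu ME.
rewrite !y_coord_xminor //; try lia.
have M0 a b : (a <= b <= n.+1)%N -> cminor M a b != 0.
  by move=> ab; exact/lt0r_neq0/cminor_gt0.
have K0 a b : (a <= b <= n.+1)%N -> cminor K a b != 0.
  by move=> ab; exact/lt0r_neq0/cminor_gt0.
(* That [c] and [d] do not vanish is read off from the nonzero corner minors of [M]. *)
have c0 a : (a <= n.+1)%N -> c a != 0.
  move=> an; have := M0 a n.+1; rewrite an leqnn => /(_ isT).
  by rewrite cE ?an ?leqnn // mulf_eq0 => /norP [].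
have d0 r : (r < n.+1)%N -> d 0 (inord r) != 0.
  move=> rn; have := M0 1%N r.+1 ltac:(lia).
  rewrite cE; last by lia.
  by rewrite subn1 /= big_nat1 !mulf_eq0 => /norP [] /norP [].
have q0 a b : (b <= n.+1)%N -> \prod_(a <= r < b) d 0 (inord r) != 0.
  move=> bn; rewrite prodf_seq_neq0; apply/allP => r; rewrite mem_index_iota => rb /=.
  by apply: d0; lia.
rewrite /xminor /=; case: k mk kn => // k mk kn.
rewrite !cE; try lia.
have k2 : (m < k)%N by lia.
(* Here [m] and [k] are the predecessors of the original indices. The overlapping windows of row
   weights are cut into common pieces for [field] to cancel. *)
have p1 : \prod_(k - m.+1 <= r < k) d 0 (inord r) =
    d 0 (inord (k - m.+1)) * \prod_(k - m <= r < k) d 0 (inord r).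
  by rewrite big_ltn; [congr (_ * \prod_(_ <= r < _) _)|]; lia.
have p2 : \prod_(k.+2 - m.+2 <= r < k.+2) d 0 (inord r) =
    d 0 (inord (k - m)) * \prod_(k.+1 - m <= r < k.+2) d 0 (inord r).
  by rewrite big_ltn; [congr (d 0 (inord _) * \prod_(_ <= r < _) _)|]; lia.
have p3 : \prod_(k.+1 - m.+2 <= r < k.+1) d 0 (inord r) =
    d 0 (inord (k - m.+1)) *
    (d 0 (inord (k - m)) * \prod_(k.+1 - m <= r < k.+1) d 0 (inord r)).
  rewrite big_ltn; last by lia.
  by congr (_ * _); rewrite big_ltn; [congr (d 0 (inord _) * \prod_(_ <= r < _) _)|]; lia.
rewrite p1 p2 p3 {p1 p2 p3}.
have -> : (k.+1 - m.+1 = k - m)%N by lia.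
have -> : (k.+2 - m.+1 = k.+1 - m)%N by lia.
set J := (n.+1 + m - k)%N.
have -> : (n.+1 + m.+1 - k = J.+1)%N by rewrite /J; lia.
have -> : (n.+1 + m - k.+1 = J.-1)%N by rewrite /J; lia.
have -> : (n.+1 + m.+1 - k.+1 = J)%N by rewrite /J; lia.
have -> : (n.+1 + m.+2 - k.+2 = J)%N by rewrite /J; lia.
have -> : (n.+1 + m.+1 - k.+2 = J.-1)%N by rewrite /J; lia.
have -> : (n.+1 + m.+2 - k.+1 = J.+1)%N by rewrite /J; lia.
have Jm : (m.+1 <= J.-1)%N by rewrite /J; lia.
have Jn : (J.+1 <= n.+1)%N by rewrite /J; lia.
have := K0 m.+1 J.-1 ltac:(lia); have := K0 m J ltac:(lia).
have := K0 m.+2 J.+1 ltac:(lia); have := K0 m J.-1 ltac:(lia).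
have := K0 m.+2 J ltac:(lia); have := K0 m.+1 J.+1 ltac:(lia).
have := K0 m.+1 J ltac:(lia).
have := c0 m ltac:(lia); have := c0 m.+1 ltac:(lia); have := c0 m.+2 ltac:(lia).
have := q0 (k - m)%N k.+1 ltac:(lia).
have := q0 (k.+1 - m)%N k.+1 ltac:(lia).
have := q0 (k.+1 - m)%N k.+2 ltac:(lia).
have := q0 (k - m)%N k ltac:(lia).
have := d0 (k - m)%N ltac:(lia).
have := d0 (k - m.+1)%N ltac:(lia).
move=> h1 h2 h3 h4 h5 h6 h7 h8 h9 h10 h11 h12 h13 h14 h15 h16.
by field; rewrite ?h1 ?h2 ?h3 ?h4 ?h5 ?h6 ?h7 ?h8 ?h9 ?h10 ?h11 ?h12 ?h13 ?h14 ?h15 ?h16.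
Qed.

End MinorRelation.

(** * Reading a Jacobi product backwards *)

Section Exchange.
Variable A : pzRingType.
Implicit Types (a : nat -> nat -> A) (r b : nat -> A).

Lemma prod_nat_mul_comm m r b :
  (forall i i', (1 <= i < i')%N -> (i' < m)%N -> GRing.comm (r i') (b i)) ->
  \prod_(1 <= i < m) r i * \prod_(1 <= i < m) b i = \prod_(1 <= i < m) (r i * b i).
Proof.
elim: m => [|[|m] IH] rb; [by rewrite !big_geq ?mulr1..|].
rewrite !(@big_nat_recr _ _ _ m.+1) //= -IH; last by move=> i i' ii' i'm; apply: rb; lia.
rewrite -!mulrA; congr (_ * _); rewrite !mulrA; congr (_ * _).
rewrite big_nat_cond; elim/big_rec: _ => [|i c /andP [im _] cE]; first by rewrite mulr1 mul1r.
by rewrite mulrA rb -?mulrA ?cE //; lia.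
Qed.

(** Passing from grouping by [k] to grouping by [i] swaps exactly the pairs [a i' k], [a i k'] with
    [i < i' < k < k']. *)
Lemma exchange_prod_comm n a :
  (forall i i' k k', (i < i')%N -> (i' < k)%N -> (k < k')%N ->
     GRing.comm (a i' k) (a i k')) ->
  \prod_(1 <= k < n) \prod_(1 <= i < k.+1) a i k.+1 =
  \prod_(1 <= i < n) \prod_(i.+1 <= k < n.+1) a i k.
Proof.
move=> aC; elim: n => [|[|n] IH]; [by rewrite !big_geq..|].
rewrite big_nat_recr //= IH.
rewrite [RHS](eq_big_nat _ _
    (F2 := fun i => \prod_(i.+1 <= k < n.+2) a i k * a i n.+2)); last first.
  by move=> i i_n; rewrite big_nat_recr //=; lia.
rewrite -prod_nat_mul_comm; last first.
  move=> i i' ii' i'n; rewrite /GRing.comm big_nat_cond.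
  elim/big_rec: _ => [|k c /andP [kn _] cE]; first by rewrite mulr1 mul1r.
  by rewrite -mulrA cE !mulrA aC //; lia.
congr (_ * _); rewrite [RHS]big_nat_recr //= [X in _ * X]big_geq // mulr1.
by [].
Qed.

End Exchange.

(** * The inverse conjugated by alternating signs *)

Section SignedInverse.
Variables (R : realType) (n : nat).
Implicit Types (A B : 'M[R]_n) (x : nat -> nat -> R).

Definition sign_row : 'rV[R]_n := \row_i (-1) ^+ i.

(* An anti-automorphism fixing every [J_mx k x], hence reversing products of these. *)
Definition signed_inv A : 'M[R]_n :=
  diag_mx sign_row *m invmx A *m diag_mx sign_row.

Lemma sign_rowK : diag_mx sign_row *m diag_mx sign_row = 1%:M.
Proof.
rewrite mulmx_diag; apply/matrixP => i j; rewrite !mxE -expr2 sqrr_sign.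
by case: eqP.
Qed.

Lemma invmx_signed_inv A :
  invmx A = diag_mx sign_row *m signed_inv A *m diag_mx sign_row.
Proof. by rewrite /signed_inv !mulmxA sign_rowK mul1mx -mulmxA sign_rowK mulmx1. Qed.

Lemma signed_inv1 : signed_inv 1%:M = 1%:M.
Proof. by rewrite /signed_inv invmx1 mulmx1 sign_rowK. Qed.

Lemma signed_invM A B : A \in unitmx -> B \in unitmx ->
  signed_inv (A *m B) = signed_inv B *m signed_inv A.
Proof.
move=> Au Bu; have ABu : A *m B \in unitmx by rewrite unitmx_mul Au.
have invM : invmx (A *m B) = invmx B *m invmx A.
  apply: (can_inj (mulKmx ABu)); rewrite mulmxV // !mulmxA -(mulmxA A) mulmxV //.
  by rewrite mulmx1 mulmxV.
rewrite /signed_inv invM !mulmxA.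
by rewrite -[_ *m diag_mx sign_row *m diag_mx sign_row]mulmxA sign_rowK mulmx1.
Qed.

Lemma mul_J_mx_opp k (t : R) : J_mx n k t *m J_mx n k (- t) = 1%:M.
Proof.
rewrite !J_mxE mulmxDr mulmx1 mulmxDl mul1mx -scalemxAl -scalemxAr mul_e_mx; last by lia.
by rewrite !scaler0 addr0 scaleNr addrK.
Qed.

Lemma J_mx_unit k (t : R) : J_mx n k t \in unitmx.
Proof. by have /mulmx1_unit [] := mul_J_mx_opp k t. Qed.

(** Inversion negates [t], and conjugation by alternating signs negates it back. *)
Lemma signed_inv_J k (t : R) : signed_inv (J_mx n k t) = J_mx n k t.
Proof.
rewrite /signed_inv; have -> : invmx (J_mx n k t) = J_mx n k (- t).
  by apply: (can_inj (mulKmx (J_mx_unit k t))); rewrite mulmxV ?J_mx_unit // mul_J_mx_opp.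
rewrite !J_mxE mulmxDr mulmxDl mulmx1 sign_rowK; congr (_ + _).
apply/matrixP => i j; rewrite mul_mx_diag mul_diag_mx !mxE.
case: andP => [[/eqP ik /eqP jk]|_]; rewrite ?mulr0 ?mul0r //.
rewrite !mulr1 (_ : (j : nat) = i.+1); last by lia.
by rewrite exprS mulN1r mulrN mulrN mulNr opprK mulrAC -expr2 sqrr_sign mul1r.
Qed.

Lemma signed_inv_prod (F : nat -> 'M[R]_n) a b : (a <= b)%N ->
  (forall i, (a <= i < b)%N -> F i \in unitmx) ->
  signed_inv (\prod_(a <= i < b) F i) =
    \prod_(a <= i < b) signed_inv (F (a + b - i.+1)%N) /\
  \prod_(a <= i < b) F i \in unitmx.
Proof.
move=> /subnKC <-; elim: (b - a)%N => {b} [|d IH] Fu.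
  by rewrite addn0 !big_geq // signed_inv1 unitmx1.
rewrite addnS (big_nat_recr (a + d)) ?leq_addr //=.
rewrite (@big_nat_recl _ _ _ (a + d)) ?leq_addr //=.
have Fd : F (a + d)%N \in unitmx by apply: Fu; lia.
have [i ai|e u] := IH; first by apply: Fu; lia.
split; last by rewrite -[_ * _]/(_ *m _) unitmx_mul u.
rewrite -[_ * F _]/(_ *m _) signed_invM // e; congr (signed_inv (F _) *m _); first lia.
apply: eq_big_nat => i ai; congr (signed_inv (F _)); lia.
Qed.

Lemma J_mx_comm k l (s t : R) : (k.+1 < l)%N ->
  GRing.comm (J_mx n k s) (J_mx n l t).
Proof.
move=> kl; rewrite /GRing.comm -![_ * _]/(_ *m _) !J_mxE.
rewrite !mulmxDr !mulmxDl !mulmx1 !mul1mx -!scalemxAl -!scalemxAr.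
have -> : e_mx R n k *m e_mx R n l = 0 by apply: mul_e_mx; lia.
have -> : e_mx R n l *m e_mx R n k = 0 by apply: mul_e_mx; lia.
by rewrite !scaler0 !addr0 addrAC.
Qed.

(** First regroup the product by [i] using [exchange_prod_comm], then reverse it: group [i] becomes
    block [n - i] with decreasing indices, which is the standard order. *)
Lemma signed_inv_jacobi_prod x :
  signed_inv (jacobi_prod n x) = jacobi_prod n (fun i j => x (n.+1 - j)%N (n.+1 - i)%N).
Proof.
rewrite /jacobi_prod /JJ_mx.
rewrite (exchange_prod_comm n (a := fun i k => J_mx n (k - i) (x i k))); last first.
  by move=> i i' k k' *; apply: J_mx_comm; lia.
have Ru i : (i <= n)%N ->
    signed_inv (\prod_(i.+1 <= k < n.+1) J_mx n (k - i) (x i k)) =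
      \prod_(i.+1 <= k < n.+1)
        J_mx n (i.+1 + n.+1 - k.+1 - i) (x i (i.+1 + n.+1 - k.+1)%N) /\
    \prod_(i.+1 <= k < n.+1) J_mx n (k - i) (x i k) \in unitmx.
  move=> i_n; have [k _|-> u] := @signed_inv_prod (fun k => J_mx n (k - i) (x i k)) i.+1 n.+1 i_n.
    exact: J_mx_unit.
  by split=> //; apply: eq_bigr => k _; exact: signed_inv_J.
have [n0|n0] := posnP n; first by rewrite !big_geq ?signed_inv1 //; lia.
pose F i := \prod_(i.+1 <= k < n.+1) J_mx n (k - i) (x i k).
have [i i_n|-> _] := @signed_inv_prod F 1 n n0; first by have [] := Ru i ltac:(lia).
apply: eq_big_nat => i i_n; rewrite add1n subSS.
have [-> _] := Ru (n - i)%N ltac:(lia).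
have -> : (n - i).+1 = (1 + (n - i))%N by lia.
rewrite big_addn (_ : (n.+1 - (n - i) = i.+1)%N); last lia.
have eqJ k k' a a' b b' : k = k' -> a = a' -> b = b' ->
  J_mx n k (x a b) = J_mx n k' (x a' b') by move=> -> -> ->.
by apply: eq_big_nat => l li; apply: eqJ; lia.
Qed.

End SignedInverse.

(** * Existence and properties of the pair (M', M'') *)

Section PrimePairs.
Variable R : realType.

(* Eliminating the first row and column leaves a block to which induction applies. *)
Lemma exists_UDL n (A : 'M[R]_n) :
  (forall m (h : 'I_m -> 'I_n), (forall a, h a = (n - m + a)%N :> nat) ->
     \det (mxsub h h A) != 0) ->
  exists U D L : 'M[R]_n,
    [/\ is_trig_mx U^T /\ forall i, U i i = 1, is_diag_mx D,
        is_trig_mx L /\ forall i, L i i = 1 & A = U *m D *m L].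
Proof.
elim: n A => [|n IH] A detA.
  exists 1%:M, 1%:M, 1%:M; split; last by apply/matrixP => -[].
  - by split; [apply/is_trig_mxP|] => -[].
  - by apply/is_diag_mxP; case.
  - by split; [apply/is_trig_mxP|] => -[].
rewrite -[n.+1]/(1 + n)%N in A detA *.
have [|U [D [L [[Ut U1] Dd [Lt L1] AE]]]] := IH (drsubmx A).
  move=> m h hE; rewrite drsubmxEsub -mxsub_comp; apply: detA => a.
  suff : (m <= n)%N by rewrite /= hE; lia.
  case: m h hE a => // m h hE _.
  by have := ltn_ord (h ord_max); rewrite hE /=; lia.
(* The hypothesis for [m = n] makes the lower right block invertible, hence also its three
   factors. *)
have /andP [/andP [Uu Du] Lu] : (U \in unitmx) && (D \in unitmx) && (L \in unitmx).
  rewrite -!unitmx_mul -AE unitmxE unitfE drsubmxEsub.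
  by apply: detA => a /=; lia.
(* The off-diagonal blocks force [u] and [l]; the Schur complement becomes the first diagonal
   entry. *)
pose u := ursubmx A *m invmx L *m invmx D.
pose l := invmx D *m invmx U *m dlsubmx A.
have block_diag1 (B : 'M[R]_n) (r : 'M[R]_(1, n)) (c : 'M[R]_(n, 1)) :
    (forall i, B i i = 1) -> forall i, block_mx (1%:M : 'M[R]_1) r c B i i = 1.
  move=> B1 i; case: (split_ordP i) => k ->; first by rewrite block_mxEul mxE eqxx.
  by rewrite block_mxEdr.
exists (block_mx 1%:M u 0 U), (block_mx (ulsubmx A - u *m D *m l) 0 0 D), (block_mx 1%:M 0 l L).
split.
- split; last exact: block_diag1.
  by rewrite tr_block_mx is_trig_block_mx // trmx0 eqxx Ut tr_scalar_mx mx11_is_trig.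
- by rewrite is_diag_block_mx // !eqxx Dd mx11_is_diag.
- split; last exact: block_diag1.
  by rewrite is_trig_block_mx // eqxx Lt mx11_is_trig.
rewrite !mulmx_block !mulmx0 !mul0mx !mul1mx !mulmx1 !add0r !addr0.
rewrite subrK -AE -[LHS]submxK; congr block_mx.
- by rewrite /u mulmxKV // mulmxKV.
- by rewrite /l !mulmxA mulmxK // ?mulmxV // mul1mx.
Qed.

(** Reflection in the antidiagonal. It reverses products and exchanges the roles of M' and M'' in
    the defining equation. *)
Definition antitr n (A : 'M[R]_n) : 'M[R]_n := P_mx R n *m A^T *m P_mx R n.

Lemma antitrE n (A : 'M[R]_n) i j : antitr A i j = A (rev_ord j) (rev_ord i).
Proof. by rewrite mul_mx_PE mul_P_mxE mxE. Qed.

Lemma antitrK n : involutive (@antitr n).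
Proof. by move=> A; apply/matrixP => i j; rewrite !antitrE !rev_ordK. Qed.

Lemma Nn_antitr n (A : 'M[R]_n) : Nn A -> Nn (antitr A).
Proof.
move=> [[_ Au] A1]; apply: NnP => [i j ji|i]; rewrite antitrE ?A1 //.
by apply: Au => /=; have := ltn_ord i; lia.
Qed.

Lemma minor_antitr n (A : 'M[R]_n) m (f g : 'I_m -> 'I_n) :
  minor f g (antitr A) =
  minor (fun a => rev_ord (g (rev_ord a))) (fun a => rev_ord (f (rev_ord a))) A.
Proof.
rewrite /minor -[LHS]det_tr -[LHS]det_mxsub_rev; congr (\det _).
by apply/matrixP => a b; rewrite [LHS]mxE [LHS]mxE [LHS]mxE antitrE mxE.
Qed.

Lemma Nn_plus_antitr n (A : 'M[R]_n) : Nn_plus A -> Nn_plus (antitr A).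
Proof.
move=> NA; apply: Nn_plusP; first by apply: Nn_antitr; case: NA.
have revI m (f : 'I_m -> 'I_n) : increasing_idx f ->
    increasing_idx (fun a => rev_ord (f (rev_ord a))).
  move=> fI a b ab; have /fI : (rev_ord b < rev_ord a)%N.
    by rewrite /=; have := ltn_ord b; lia.
  by rewrite /=; have := ltn_ord (f (rev_ord a)); lia.
move=> m f g fI gI fg; rewrite minor_antitr; apply: Nn_plus_minor_gt0 => //; try exact: revI.
by move=> a; rewrite /=; have := fg (rev_ord a); lia.
Qed.

Variable n : nat.
Implicit Types (M D : 'M[R]_n.+1).
Local Notation P := (P_mx R n.+1).

Lemma upper_triangular_diag D : is_diag_mx D -> upper_triangular D.
Proof. by move=> /is_diag_mxP D0 i j ji; rewrite D0 // gtn_eqF. Qed.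

Lemma mulPP (A : 'M[R]_n.+1) : P *m (P *m A) = A.
Proof. by rewrite mulmxA P_mxK mul1mx. Qed.

Lemma mul_conjP (A B C : 'M[R]_n.+1) :
  P *m A *m P *m (P *m B *m P) *m (P *m A *m P *m C) = P *m (A *m B *m A) *m P *m C.
Proof. by rewrite -!mulmxA !mulPP. Qed.

Lemma prime_pair_diag_rel M W1 W2 D : P *m M *m P = W1 *m P *m D *m W2 ->
  M = diag_mx (const_mx 1) *m (P *m W1 *m P) *m (D *m W2 *m P).
Proof.
move=> eM; rewrite diag_const_mx mul1mx.
transitivity (P *m (W1 *m P *m D *m W2) *m P); last by rewrite !mulmxA.
by rewrite -eM -!mulmxA mulPP P_mxK mulmx1.
Qed.

Lemma prime_pair_antitr M W1 W2 D : is_diag_mx D ->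
  P *m M *m P = W1 *m P *m D *m W2 ->
  P *m antitr M *m P = antitr W2 *m P *m D *m antitr W1.
Proof.
move=> /diag_mxP [d ->] /prime_pair_diag_rel.
rewrite diag_const_mx mul1mx => /(congr1 trmx) eM.
have trP : P^T = P.
  by apply/matrixP => i j; rewrite mxE !P_mxE -(inj_eq rev_ord_inj) rev_ordK eq_sym.
have -> : P *m antitr M *m P = M^T.
  by rewrite /antitr -!mulmxA mulPP P_mxK mulmx1.
by rewrite eM !trmx_mul !trP tr_diag_mx /antitr -!mulmxA mulPP.
Qed.

(** By [cminor_rel] the corner minors of [W1] are those of [M] at reflected row indices, divided by
    [c m]; positive corner minors give Jacobi coordinates. *)
Lemma prime_left_Nn_plus M W1 W2 D : Nn_plus M -> Nn W1 -> Nn W2 -> is_diag_mx D ->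
  P *m M *m P = W1 *m P *m D *m W2 -> Nn_plus W1.
Proof.
move=> NM N1 [[_ W2u] _] Dd /prime_pair_diag_rel eM.
have Bu : upper_triangular (D *m W2).
  by apply: upper_triangular_mul => //; exact: upper_triangular_diag.
have [c cE] := cminor_rel Bu eM.
have cW m j : (m <= j <= n.+1)%N -> cminor M m j = cminor W1 m (n.+1 + m - j) * c m.
  by move=> mj; rewrite cE // big1 ?mul1r // => r _; rewrite mxE.
(* At [j = m] the corner minor of [W1] is principal and equals 1, so [c m] is a corner minor of
   [M]. *)
have c0 m : (m <= n.+1)%N -> 0 < c m.
  move=> mn; have := cminor_gt0 NM (m := m) (j := m) ltac:(lia).
  by rewrite cW ?leqnn // addnK cminor_last // mul1r.
have [//|x xW] := @jacobi_coord_exists R n W1 N1; last exact: jacobi_coord_Nn_plus xW.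
move=> m j mj; have := cminor_gt0 NM (m := m) (j := (n.+1 + m - j)%N) ltac:(lia).
rewrite cW; last by lia.
by rewrite (_ : (n.+1 + m - (n.+1 + m - j) = j)%N) ?pmulr_lgt0 ?c0 //; lia.
Qed.

Lemma prime_pair_exists M : Nn_plus M -> exists W, is_prime_pair M W.
Proof.
move=> NM.
(* The trailing principal minors of [P *m M] are, up to sign, the corner minors [cminor M m m]. *)
have [|U [D [L [[Ut U1] Dd [Lt L1] PME]]]] := @exists_UDL _ (P *m M).
  move=> m h hE; have mn : (m <= n.+1)%N.
    case: m h hE => // m h hE.
    by have := ltn_ord (h ord_max); rewrite hE /=; lia.
  have := cminor_gt0 NM (m := m) (j := m) ltac:(lia).
  move=> /lt0r_neq0; apply: contra_neq => det0; rewrite /cminor /minor.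
  set S := mxsub _ _ M.
  have : \det (row_perm (perm rev_ord_inj) S) = 0.
    rewrite -det0; congr (\det _); apply/matrixP => a b.
    rewrite [RHS]mxE mul_P_mxE !mxE permE; congr (M _ _); apply/val_inj.
      by rewrite /= inordK ?hE; have := ltn_ord a; lia.
    by rewrite /= inordK ?hE; have := ltn_ord b; lia.
  by rewrite row_permE det_mulmx det_perm => /eqP; rewrite mulf_eq0 signr_eq0 => /eqP.
have NU : Nn U by apply: NnP => // i j ij; move/is_trig_mxP: Ut => /(_ _ _ ij); rewrite mxE.
have NW2 : Nn (P *m L *m P).
  apply: NnP => [i j ij|i]; rewrite mul_mx_PE mul_P_mxE //.
  by move/is_trig_mxP: Lt; apply; rewrite /=; have := ltn_ord i; lia.
have Dd' : is_diag_mx (P *m D *m P).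
  have /diag_mxP [d ->] := Dd; rewrite P_mx_diag; exact: diag_mx_is_diag.
have eM : P *m M *m P = U *m P *m (P *m D *m P) *m (P *m L *m P).
  by rewrite PME -!mulmxA !mulPP.
have N1 : Nn_plus U := prime_left_Nn_plus NM NU NW2 Dd' eM.
exists (U, P *m L *m P); split => //=; last by exists (P *m D *m P).
(* The right factor is handled as the left factor for [antitr M]. *)
rewrite -(antitrK (P *m L *m P)); apply/Nn_plus_antitr.
apply: (@prime_left_Nn_plus (antitr M) _ (antitr U) (P *m D *m P)) => //.
- exact: Nn_plus_antitr.
- exact: Nn_antitr.
- exact: Nn_antitr.
exact: prime_pair_antitr.
Qed.

Lemma prime_pairP M : Nn_plus M -> is_prime_pair M (prime_pair M).
Proof.
move=> /prime_pair_exists [W MW]; exact: (@xgetI _ _ [set W | is_prime_pair M W] W).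
Qed.

Lemma Nn_plus_mprime M : Nn_plus M -> Nn_plus (mprime M).
Proof. by move=> /prime_pairP []. Qed.

Lemma Nn_plus_mdprime M : Nn_plus M -> Nn_plus (mdprime M).
Proof. by move=> /prime_pairP []. Qed.

Lemma y_coord_mprime M i j : Nn_plus M -> (1 <= i)%N -> (i < j)%N -> (j <= n)%N ->
  y_coord i j (mprime M) = (y_coord i (n.+1 + i - j) M)^-1.
Proof.
move=> NM i1 ij jn; have [N1 [[[_ W2u] _] _] [D Dd eM]] := prime_pairP NM.
have Bu : upper_triangular (D *m (prime_pair M).2).
  by apply: upper_triangular_mul => //; exact: upper_triangular_diag.
rewrite (y_coord_rel Bu (prime_pair_diag_rel eM)) //; try lia.
by rewrite invrK; congr y_coord; lia.
Qed.

(** The index map on the coordinates reverses the diagonal shift, so numerator and denominator of y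
    change places. *)
Lemma y_coord_signed_inv M i j : Nn_plus M -> (1 <= i)%N -> (i < j)%N -> (j <= n)%N ->
  Nn_plus (signed_inv M) /\
  y_coord i j (signed_inv M) = (y_coord (n.+1 - j) (n.+1 - i) M)^-1.
Proof.
move=> /Nn_plus_jacobi_coord xM i1 ij jn; have [x0 ME] := xM.
have xK : is_jacobi_coord (signed_inv M)
    (fun i j => jacobi_coord M (n.+2 - j)%N (n.+2 - i)%N).
  split=> [k l k1 kl ln|]; first by apply: x0; lia.
  by rewrite {1}ME signed_inv_jacobi_prod.
split; first exact: jacobi_coord_Nn_plus xK.
rewrite (y_coordE xK) // (y_coordE xM); try lia.
rewrite invf_div !subSS -!subSn //; lia.
Qed.

Lemma y_coord_mdprime M i j : Nn_plus M -> (1 <= i)%N -> (i < j)%N -> (j <= n)%N ->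
  y_coord i j (mdprime M) = (y_coord (j - i) j M)^-1.
Proof.
move=> NM i1 ij jn; have [N1 N2 [D Dd eM]] := prime_pairP NM.
(* This replaces the coordinate of [M] by one of M', leaving a relation between M' and M''. *)
have := y_coord_mprime NM (i := (j - i)%N) (j := (n.+1 - i)%N)
  ltac:(lia) ltac:(lia) ltac:(lia).
rewrite (_ : (n.+1 + (j - i) - (n.+1 - i) = j)%N) => [<-|]; last by lia.
rewrite /mprime /mdprime; move: N1 N2 eM; case: (prime_pair M) => W1 W2 /= N1 N2 eM.
have [[[Mu0 Mu] _] _] := NM; have [[[W1u _] _] _] := N1.
have [NK _] := y_coord_signed_inv N1 i1 ij jn.
have [d dE] := diag_mxP _ Dd.
have d0 k : d 0 k != 0.
  have Pu : P \in unitmx by have /mulmx1_unit [] := P_mxK R n.+1.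
  have : P *m M *m P \in unitmx by rewrite !unitmx_mul Pu Mu0.
  rewrite eM !unitmx_mul => /andP [/andP [_ Du] _].
  move: Du; rewrite dE unitmxE det_diag unitfE prodf_seq_neq0 => /allP /(_ k).
  by rewrite mem_index_enum => /(_ isT).
pose S := diag_mx (sign_row R n.+1).
(* Solving the defining equation for M'' produces [invmx W1], that is, [signed_inv W1] between two
   sign matrices. The left one and the inverse of [D] go into the weights [d'], the right one into
   the upper triangular factor. *)
pose d' : 'rV[R]_n.+1 := \row_k ((d 0 k)^-1 * sign_row R n.+1 0 (rev_ord k)).
have DE : D *m diag_mx d' = P *m S *m P.
  rewrite dE P_mx_diag mulmx_diag; congr diag_mx; apply/rowP => k; rewrite !mxE.
  by rewrite mulVKf.
have PSPu : upper_triangular (P *m S *m P).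
  by apply/upper_triangular_diag; rewrite P_mx_diag diag_mx_is_diag.
have Bu : upper_triangular (P *m S *m P *m M) by exact: upper_triangular_mul.
have eW2 : W2 = diag_mx d' *m (P *m signed_inv W1 *m P) *m (P *m S *m P *m M *m P).
  have Du : D \in unitmx.
    rewrite dE unitmxE det_diag unitfE; apply/prodf_neq0 => k _; exact: d0.
  have eDW : D *m W2 = P *m invmx W1 *m P *m M *m P.
    by rewrite -!mulmxA [P *m (M *m P)]mulmxA eM -!mulmxA mulKmx // mulPP.
  apply: (can_inj (mulKmx Du)); rewrite -(mulmxA _ M P) !(mulmxA D) DE mul_conjP.
  by rewrite -invmx_signed_inv eDW !mulmxA.
rewrite (y_coord_rel Bu eW2) //.
have [_ ->] := y_coord_signed_inv N1 (i := i) (j := (n.+1 + i - j)%N)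
  ltac:(lia) ltac:(lia) ltac:(lia).
rewrite invrK; congr y_coord; lia.
Qed.

End PrimePairs.

Theorem proposition6 (R : realType) (n : nat) (hn : (3 <= n)%N)
    (M : 'M[R]_n) (hM : Nn_plus M)
    (i j : nat) (hi : (1 <= i)%N) (hij : (i < j)%N) (hj : (j <= n - 1)%N) :
  [/\ y_coord i j (mprime M) = ybar_coord i (n + i - j) M,
      y_coord i j (mdprime M) = ybar_coord (j - i) j M,
      y_coord i j (mprime (mdprime (mprime M))) =
        y_coord i j (mdprime (mprime (mdprime M))) &
      ybar_coord i j (mprime (mdprime (mprime M))) =
        ybar_coord i j (mdprime (mprime (mdprime M)))].
Proof.
case: n hn M hM hj => [|n] hn M NM hj; first by rewrite ltn0 in hn.
have jn : (j <= n)%N by rewrite subn1 in hj.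
have N1 := Nn_plus_mprime NM; have N2 := Nn_plus_mdprime NM.
have N12 := Nn_plus_mdprime N1; have N21 := Nn_plus_mprime N2.
have N121 := Nn_plus_mprime N12; have N212 := Nn_plus_mdprime N21.
(* Both sides reduce to the inverse of y at [(n + 1 - j, n + 1 - i)] for [M]: the index involutions
   of the two maps satisfy the braid relation. *)
have y3 : y_coord i j (mprime (mdprime (mprime M))) =
    y_coord i j (mdprime (mprime (mdprime M))).
  rewrite (y_coord_mprime N12) // (y_coord_mdprime N1); [|lia..].
  rewrite (y_coord_mprime NM); [|lia..].
  rewrite (y_coord_mdprime N21) // (y_coord_mprime N2); [|lia..].
  rewrite (y_coord_mdprime NM); [|lia..].
  by rewrite !invrK; congr (y_coord _ _ M)^-1; lia.
split; last by rewrite (ybar_coordE N121) // (ybar_coordE N212) // y3.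
- by rewrite (y_coord_mprime NM) // (ybar_coordE NM) //; lia.
- by rewrite (y_coord_mdprime NM) // (ybar_coordE NM) //; lia.
- exact: y3.
Qed.
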